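(* Let $C \subseteq \mathbb{R}^n$ be a convex set containing the origin and let $\delta \geq 0$. If $P \subseteq \mathbb{R}^n$ is a polyhedron containing the origin that is a homogeneous $\delta$-approximation of $C$, then the polar set $P^{\circ}$ is a homogeneous $\delta$-approximation of the polar set $C^{\circ}$.
   Context: A polyhedron is an intersection of finitely many closed halfspaces. For a set $M \subseteq \mathbb{R}^n$, the polar is $M^{\circ} = \{u \in \mathbb{R}^n \mid x^{\mathsf{T}}u \leq 1 \text{ for all } x \in M\}$. $\operatorname{cone} M$ denotes the conical hull, i.e. the smallest convex cone containing $M$ (cones are closed under multiplication by nonnegative scalars, hence contain $0$; $\operatorname{cone}\emptyset = \{0\}$), and $\operatorname{cl}$ denotes closure. The homogenization of a convex set $C \subseteq \mathbb{R}^n$ is the cone $\operatorname{homog} C = \operatorname{cl}\operatorname{cone}(C \times \{1\}) \subseteq \mathbb{R}^{n+1}$. $B$ denotes the closed Euclidean unit ball of the appropriate dimension, and $d(x,M) = \inf\{\|x-y\| \mid y \in M\}$ with the Euclidean norm. The Hausdorff distance is $d_{\mathsf{H}}(C_1,C_2) = \max\{\sup_{x \in C_1} d(x,C_2), \sup_{x \in C_2} d(x,C_1)\}$. The truncated Hausdorff distance of convex cones $K_1,K_2$ is $d_{\mathsf{tH}}(K_1,K_2) = d_{\mathsf{H}}(K_1 \cap B, K_2 \cap B)$. For a convex set $C \subseteq \mathbb{R}^n$ and $\delta \geq 0$, a polyhedron $P \subseteq \mathbb{R}^n$ is a homogeneous $\delta$-approximation of $C$ if $d_{\mathsf{tH}}(\operatorname{homog}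 P, \operatorname{homog} C) \leq \delta$. *)

(* Defs.v *)
From HB Require Import structures.
From mathcomp Require Import all_boot all_order all_algebra.
From mathcomp Require Import all_classical all_reals all_analysis.

Set Implicit Arguments.
Unset Strict Implicit.
Unset Printing Implicit Defensive.

Import Order.TTheory GRing.Theory Num.Theory.
Import numFieldNormedType.Exports.

Local Open Scope classical_set_scope.
Local Open Scope ring_scope.

(* R^n is 'cV[R]_n. The library norm on matrices is the max-norm, so the
   Euclidean norm is introduced separately; both induce the same topology, so
   the library [closure] is the Euclidean closure. *)

Definition dotv (R : realType) (n : nat) (x u : 'cV[R]_n) : R :=
  (x^T *m u) 0 0.

Definition eucl_norm (R : realType) (n : nat) (x : 'cV[R]_n) : R :=
  Num.sqrt (dotv x x).

Definition eucl_ball (R : realType) (n : nat) : set 'cV[R]_n :=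
  [set x | eucl_norm x <= 1].

Arguments eucl_ball : clear implicits.

(* A halfspace has a nonzero normal vector; the intersection of zero
   halfspaces is the whole space. *)
Definition closed_halfspace (R : realType) (n : nat) (H : set 'cV[R]_n) : Prop :=
  exists (a : 'cV[R]_n) (b : R), a != 0 /\ H = [set x | dotv a x <= b].

Definition polyhedron (R : realType) (n : nat) (P : set 'cV[R]_n) : Prop :=
  exists (m : nat) (H : 'I_m -> set 'cV[R]_n),
    (forall i, closed_halfspace (H i)) /\ P = \bigcap_i H i.

Definition polar (R : realType) (n : nat) (M : set 'cV[R]_n) : set 'cV[R]_n :=
  [set u | forall x, M x -> dotv x u <= 1].

(* [K 0] excludes the empty set, so that the conical hull of the empty set is
   the zero cone. *)
Definition convex_cone (R : realType) (n : nat) (K : set 'cV[R]_n) : Prop :=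
  [/\ K 0, convex_set K & forall (t : R) x, 0 <= t -> K x -> K (t *: x)].

Definition conical_hull (R : realType) (n : nat) (M : set 'cV[R]_n) :
    set 'cV[R]_n :=
  smallest (@convex_cone R n) M.

Definition homog (R : realType) (n : nat) (C : set 'cV[R]_n) :
    set 'cV[R]_(n + 1) :=
  closure (conical_hull [set col_mx x (const_mx 1 : 'cV[R]_1) | x in C]).

(* Distances take values in the extended reals, so that no infimum or supremum
   is given a default value. *)
Definition eucl_dist (R : realType) (n : nat) (x : 'cV[R]_n)
    (M : set 'cV[R]_n) : \bar R :=
  ereal_inf [set (eucl_norm (x - y))%:E | y in M].

Definition hausdorff_dist (R : realType) (n : nat) (C1 C2 : set 'cV[R]_n) :
    \bar R :=
  maxe (ereal_sup [set eucl_dist x C2 | x in C1])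
       (ereal_sup [set eucl_dist x C1 | x in C2]).

Definition trunc_hausdorff_dist (R : realType) (n : nat)
    (K1 K2 : set 'cV[R]_n) : \bar R :=
  hausdorff_dist (K1 `&` eucl_ball R n) (K2 `&` eucl_ball R n).

Definition homog_approx (R : realType) (n : nat) (delta : R)
    (C P : set 'cV[R]_n) : Prop :=
  polyhedron P /\
  (trunc_hausdorff_dist (homog P) (homog C) <= delta%:E)%E.

(* Main.v *)
Require Import Defs.
From mathcomp Require Import all_boot all_order all_algebra.
From mathcomp Require Import all_classical all_reals all_analysis.
From mathcomp Require Import ring lra.

(* When 0 is in C, homog (polar C) is the polar cone of homog C up to the sign
   of the last coordinate, so the estimate reduces to the Walkup-Wets
   isometry: passing to polar cones does not increase the truncated Hausdorff
   distance of closed convex cones. If u is in the polar of K2 and u = p + q is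
   its Moreau decomposition along K1, the distance from u to the polar of K1
   is |p| = <p/|p|, u>, and this is at most delta because p/|p| is within delta
   of K2, where u is nonpositive. Polyhedrality of the polar of P
   comes from Fourier-Motzkin elimination, which describes by inequalities the
   cone generated by (0, 1) and the (a_i, b_i), where the inequalities
   <a_i, x> <= b_i define P. *)

Import Order.TTheory GRing.Theory Num.Theory.
Import numFieldNormedType.Exports.

Local Open Scope classical_set_scope.
Local Open Scope ring_scope.

(** * Inner product, Euclidean norm and convex cones *)

Section EuclideanSpace.
Context {R : realType} {n : nat}.
Implicit Types (x y z u : 'cV[R]_n) (K : set 'cV[R]_n) (a t : R).

Lemma dotvE x u : dotv x u = \sum_i x i 0 * u i 0.
Proof. by rewrite /dotv mxE; apply: eq_bigr => i _; rewrite mxE. Qed.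

Lemma dotvC x u : dotv x u = dotv u x.
Proof. by rewrite !dotvE; apply: eq_bigr => i _; rewrite mulrC. Qed.

Lemma dotvDr x y u : dotv x (y + u) = dotv x y + dotv x u.
Proof. by rewrite /dotv mulmxDr mxE. Qed.

Lemma dotvZr a x u : dotv x (a *: u) = a * dotv x u.
Proof. by rewrite /dotv -scalemxAr mxE. Qed.

Lemma dotvNr x u : dotv x (- u) = - dotv x u.
Proof. by rewrite /dotv mulmxN mxE. Qed.

Lemma dotv0r x : dotv x 0 = 0.
Proof. by rewrite /dotv mulmx0 mxE. Qed.

Lemma dotvDl x y u : dotv (x + y) u = dotv x u + dotv y u.
Proof. by rewrite dotvC dotvDr !(dotvC u). Qed.

Lemma dotvZl a x u : dotv (a *: x) u = a * dotv x u.
Proof. by rewrite dotvC dotvZr (dotvC u). Qed.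

Lemma dotvNl x u : dotv (- x) u = - dotv x u.
Proof. by rewrite dotvC dotvNr (dotvC u). Qed.

Lemma dotv0l x : dotv 0 x = 0.
Proof. by rewrite dotvC dotv0r. Qed.

Definition dotv_linE :=
  (dotvDl, dotvDr, dotvNl, dotvNr, dotvZl, dotvZr, dotv0l, dotv0r).

Lemma dotvv_ge0 x : 0 <= dotv x x.
Proof. by rewrite dotvE sumr_ge0 // => i _; rewrite -expr2 sqr_ge0. Qed.

Lemma coord_sqr_le x i : x i 0 ^+ 2 <= dotv x x.
Proof.
rewrite dotvE (bigD1 i) //= -expr2 lerDl sumr_ge0 // => j _.
by rewrite -expr2 sqr_ge0.
Qed.

Lemma dotvv_eq0 x : dotv x x = 0 -> x = 0.
Proof.
move=> x0; apply/matrixP => i j; rewrite ord1 mxE.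
by apply/eqP; rewrite -sqrf_eq0 eq_le sqr_ge0 -x0 coord_sqr_le.
Qed.

Lemma eucl_norm_ge0 x : 0 <= eucl_norm x.
Proof. exact: sqrtr_ge0. Qed.

Lemma eucl_norm_sqr x : eucl_norm x ^+ 2 = dotv x x.
Proof. by rewrite sqr_sqrtr ?dotvv_ge0. Qed.

Lemma eucl_norm_le a x : 0 <= a -> (eucl_norm x <= a) = (dotv x x <= a ^+ 2).
Proof.
by move=> a0; rewrite -eucl_norm_sqr ler_sqr // nnegrE eucl_norm_ge0.
Qed.

Lemma cauchy_schwarz x u : dotv x u <= eucl_norm x * eucl_norm u.
Proof.
apply: le_trans (ler_norm _) _.
rewrite -ler_sqr ?nnegrE ?mulr_ge0 ?eucl_norm_ge0 // exprMn !eucl_norm_sqr.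
rewrite real_normK ?num_real //.
(* With the abbreviations below, this square expands to q (q r - p^2); dividing by q needs q > 0, so
   q = 0 is treated apart. *)
have := dotvv_ge0 (dotv u u *: x - dotv x u *: u).
rewrite !dotv_linE (dotvC u x).
set p := dotv x u; set q := dotv u u; set r := dotv x x => H.
have [q0|q0] := eqVneq q 0.
  by rewrite /p (dotvv_eq0 _ q0) dotv0r expr0n /= mulr_ge0 ?dotvv_ge0.
have qp : 0 < q by rewrite lt_def q0 dotvv_ge0.
by rewrite -subr_ge0 -(pmulr_rge0 _ qp); lra.
Qed.

Lemma convex_coneP K : convex_cone K <->
  [/\ K 0, forall x y, K x -> K y -> K (x + y)
    & forall t x, 0 <= t -> K x -> K (t *: x)].
Proof.
split=> -[K0 KD KZ]; split => //.
- move=> x y Kx Ky; have h0 : (0 : R) <= 2^-1 by lra.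
  have h1 : (2^-1 : R) <= 1 by lra.
  (* The sum is twice the midpoint. *)
  have := KD x y (Itv01 h0 h1) (mem_set Kx) (mem_set Ky).
  rewrite inE => Kxy; have := KZ 2 _ (ler0n R 2) Kxy.
  congr K; rewrite /conv /= scalerDr !scalerA /unstable.onem mulrBr.
  by rewrite mulfV ?pnatr_eq0 // mulr1 (_ : 2 - 1 = 1) ?scale1r //; ring.
- move=> x y l; rewrite !inE => Kx Ky.
  by apply: KD; apply: KZ => //; rewrite ?subr_ge0 ?ge0 ?le1.
Qed.

Lemma dotv_continuous (T : topologicalType) (f g : T -> 'cV[R]_n) :
  continuous f -> continuous g -> continuous (fun p => dotv (f p) (g p)).
Proof.
move=> cf cg; under eq_fun do rewrite dotvE.
apply: (@continuous_big _ _ +%R); first exact: add_continuous.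
move=> i _ p; apply: cvgM.
- exact: (cvg_comp _ _ (cf p) (@coord_continuous R n 1 i 0 (f p))).
- exact: (cvg_comp _ _ (cg p) (@coord_continuous R n 1 i 0 (g p))).
Qed.

End EuclideanSpace.

(** * Elimination of a multiplier and finitely generated cones *)

Section Farkas.
Context {R : realType} {m : nat}.
Implicit Types (x z g w v : 'cV[R]_m) (s : seq 'cV[R]_m) (t : R).

(** The result of eliminating t >= 0 from the system <w, z> <= t <w, g>, w in [s]. Rows with <w, g>
    > 0 bound t from below, those with <w, g> < 0 from above. Each pair of bounds gives one combined
    row; the latter rows are also kept by themselves, because the upper bounds must be compatible
    with t >= 0. *)
Definition fourier_motzkin g s : seq 'cV[R]_m :=
  [seq w <- s | dotv w g <= 0] ++
  [seq dotv w g *: v - dotv v g *: w | w <- [seq w <- s | 0 < dotv w g],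
                                       v <- [seq v <- s | dotv v g < 0]].

Lemma fourier_motzkinP g s z :
  (forall w, w \in fourier_motzkin g s -> dotv w z <= 0) <->
  exists2 t, 0 <= t & forall w, w \in s -> dotv w (z - t *: g) <= 0.
Proof.
split=> [H|[t t0 H] w].
  (* The greatest lower bound imposed on t, with 0 among the bounds; the combined rows place it
     below every upper bound. *)
  pose t := \big[Num.max/0]_(w <- s | 0 < dotv w g) (dotv w z / dotv w g).
  exists t.
    by rewrite /t; elim/big_rec: _ => // i x _ x0; rewrite le_max x0 orbT.
  move=> w ws; rewrite !dotv_linE subr_le0.
  have [wg|wg|wg] := ltgtP (dotv w g) 0.
  - rewrite -ler_ndivlMr // /t big_seq_cond.
    elim/big_ind: _ => [|a b ha hb|v /andP[vs vg]].
    + rewrite ler_ndivlMr // mul0r; apply: H.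
      by rewrite mem_cat mem_filter ltW ?ws.
    + by rewrite ge_max ha.
    + have : dotv (dotv v g *: w - dotv w g *: v) z <= 0.
        apply: H; rewrite mem_cat; apply/orP; right.
        by apply/allpairsP; exists (v, w); rewrite !mem_filter vg wg vs ws.
      by rewrite !dotv_linE ler_ndivlMr // mulrAC ler_pdivlMr //; lra.
  - rewrite -ler_pdivrMr // /t.
    exact: (le_bigmax_seq _ w (fun v => 0 < dotv v g)
      (fun v => dotv v z / dotv v g)) ws wg.
  - rewrite wg mulr0; apply: H; rewrite mem_cat mem_filter wg lexx ws //.
rewrite mem_cat => /orP[].
  rewrite mem_filter => /andP[wg ws].
  have := H _ ws; rewrite !dotv_linE subr_le0 => /le_trans; apply.
  by rewrite mulr_ge0_le0.
case/allpairsP => -[v1 v2] /= [].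
rewrite !mem_filter => /andP[h1 v1s] /andP[h2 v2s] ->.
have := H _ v1s; have := H _ v2s; rewrite !dotv_linE.
nra.
Qed.

(* The double description of the cone generated by [G]: the first conjunct says
   that the cone satisfies the inequalities in [s], the second, in dual form,
   that they force membership in it. *)
Lemma farkas (G : seq 'cV[R]_m) : exists s : seq 'cV[R]_m,
  (forall w g, w \in s -> g \in G -> dotv w g <= 0) /\
  (forall z, (forall w, w \in s -> dotv w z <= 0) ->
   forall x, (forall g, g \in G -> dotv x g <= 0) -> dotv x z <= 0).
Proof.
elim: G => [|g G [s [sG Gs]]].
  (* No generators: the cone is {0}, cut out by z_i <= 0 and -z_i <= 0. *)
  exists ([seq delta_mx i 0 | i <- enum 'I_m] ++
          [seq - delta_mx i 0 | i <- enum 'I_m]).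
  split=> // z Hz x _.
  suff -> : z = 0 by rewrite dotv0r.
  have dotv_delta i : dotv (delta_mx i 0) z = z i 0.
    rewrite dotvE (bigD1 i) //= mxE !eqxx mul1r big1 ?addr0 // => j ji.
    by rewrite mxE (negPf ji) mul0r.
  apply/matrixP => i j; rewrite ord1 mxE -dotv_delta; apply/eqP.
  rewrite eq_le -[0 <= _]oppr_le0 -dotvNl.
  apply/andP; split; apply: Hz; rewrite mem_cat; apply/orP; [left|right];
    by apply/mapP; exists i; rewrite ?mem_enum.
(* A point z is in the enlarged cone iff z - t g is in the cone of [G] for some t >= 0. The new
   generator satisfies the inequalities with t = 1, the old ones with t = 0. *)
exists (fourier_motzkin g s).
split=> [w h ws|z /fourier_motzkinP [t t0 Hz] x xG].
  move=> hG; move: w ws; apply/fourier_motzkinP; move: hG.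
  rewrite inE => /orP[/eqP ->|hG].
    by exists 1 => // w _; rewrite scale1r subrr dotv0r.
  by exists 0 => // w ws; rewrite scale0r subr0; apply: sG.
have := Gs _ Hz x (fun h hG => xG h (@mem_behead _ (g :: G) h hG)).
rewrite !dotv_linE subr_le0 => /le_trans; apply.
by rewrite mulr_ge0_le0 // xG // mem_head.
Qed.
End Farkas.

(** Transposition is a homeomorphism onto row vectors, where [rV_compact] makes the box [-M, M]^n
    compact. *)
Lemma closed_bounded_compact_cV {R : realType} {n : nat} (A : set 'cV[R]_n)
    (M : R) :
  closed A -> (forall x, A x -> forall i, `|x i 0| <= M) -> compact A.
Proof.
move=> Acl AM.
have trC (p q : nat) : continuous (@trmx R p q).
  move=> x B /nbhs_ballP [e e0 eB]; apply/nbhs_ballP.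
  exists e => // y [_ xy]; apply: eB.
  by split=> // i j; rewrite !mxE; apply: xy.
suff At : compact (@trmx R n 1 @` A).
  rewrite (_ : A = @trmx R 1 n @` (@trmx R n 1 @` A)).
    by apply: continuous_compact => //; apply: continuous_subspaceT; apply: trC.
  rewrite image_comp; apply/seteqP; split=> [x Ax|_ [x Ax <-]] /=.
    by exists x => //=; rewrite trmxK.
  by rewrite trmxK.
apply: (subclosed_compact (B := [set v : 'rV[R]_n |
  forall i, [set` `[- M, M]] (v ord0 i)])).
- rewrite (_ : _ @` A = @trmx R 1 n @^-1` A).
    by apply: preimage_closed => // x _; apply: trC.
  apply/seteqP; split=> [_ [x Ax <-]|x Ax] /=; first by rewrite trmxK.
  by exists x^T => //; rewrite trmxK.
- apply: (@rV_compact _ _ (fun=> [set` `[- M, M]])) => _.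
  exact: segment_compact.
- by move=> _ [x Ax <-] i /=; rewrite mxE in_itv /= -ler_norml AM.
Qed.

(** * Nearest points and the Moreau decomposition *)

Section Moreau.
Context {R : realType} {n : nat}.
Implicit Types (x y z u p : 'cV[R]_n) (K : set 'cV[R]_n) (a t : R).

Definition polar_cone K : set 'cV[R]_n :=
  [set y | forall x, K x -> dotv x y <= 0].

Lemma nearest_point K u : closed K -> K 0 ->
  exists2 p, K p &
    forall x, K x -> dotv (u - p) (u - p) <= dotv (u - x) (u - x).
Proof.
move=> Kcl K0; pose f x := dotv (u - x) (u - x).
have fc : continuous f.
  have uc : continuous (fun x => u - x).
    move=> x; apply: (@continuousB _ _ _ (cst u) id); last exact: cvg_id.
    exact: cst_continuous.
  exact: dotv_continuous.
(* Only points at least as close to u as 0 compete for the minimum, and they form a bounded set. *)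
pose A := K `&` f @^-1` [set r | r <= dotv u u].
have A0 : A 0 by split=> //=; rewrite /f subr0.
have Acpt : compact A.
  apply: (@closed_bounded_compact_cV _ _ _ (eucl_norm u + eucl_norm u)).
    apply: closedI => //; apply: preimage_closed; last exact: closed_le.
    by move=> x _; apply: fc.
  have coord_le x i : `|x i 0| <= eucl_norm x.
    by rewrite -sqrtr_sqr ler_sqrt ?dotvv_ge0 // coord_sqr_le.
  move=> x [Kx /= fx] i; rewrite -[x](subKr u) !mxE.
  apply: le_trans (ler_normB _ _) _; apply: lerD; first exact: coord_le.
  have := coord_le (u - x) i; rewrite !mxE => /le_trans; apply.
  by rewrite ler_sqrt // dotvv_ge0.
have [||p /set_mem [Kp fp] pmin] := @compact_EVT_min _ _ f A _ Acpt.
- by exists 0.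
- exact: continuous_subspaceT.
exists p => // x Kx; have [fx|/ltW fx] := leP (f x) (dotv u u).
  by apply: pmin; apply/mem_set.
exact: le_trans fp fx.
Qed.

(** First-order optimality: divide by s and let s tend to 0. For t > 0 the choice s = t / (a + t) is
    already contradictory. *)
Lemma le0_of_quadratic a t : 0 <= a ->
  (forall s : R, 0 < s -> s <= 1 -> 2 * (s * t) <= s ^+ 2 * a) -> t <= 0.
Proof.
move=> a0 H; rewrite leNgt; apply/negP => t0.
have at0 : 0 < a + t by lra.
have s0 : 0 < t / (a + t) by rewrite divr_gt0.
have s1 : t / (a + t) <= 1 by rewrite ler_pdivrMr // mul1r lerDr.
have := H _ s0 s1; rewrite mulrCA expr2 -mulrA ler_pM2l //.
rewrite mulrAC ler_pdivlMr // => {}H.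
have := mulr_gt0 t0 t0; have := mulr_ge0 a0 (ltW t0). nra.
Qed.

Lemma moreau K u : closed K -> convex_cone K ->
  exists2 p, K p & polar_cone K (u - p) /\ dotv p (u - p) = 0.
Proof.
move=> Kcl /convex_coneP [K0 KD KZ].
have [p Kp pmin] := nearest_point K u Kcl K0.
have polp : polar_cone K (u - p).
  move=> y Ky; apply: (le0_of_quadratic (dotv y y)); first exact: dotvv_ge0.
  (* Compare p with p + s y. *)
  move=> s s0 _; have := pmin _ (KD _ _ Kp (KZ s y (ltW s0) Ky)).
  rewrite opprD addrA; move: (u - p) => q.
  by rewrite !dotv_linE (dotvC q y); lra.
exists p => //; split=> //; apply/eqP; rewrite eq_le polp //= -oppr_le0.
apply: (le0_of_quadratic (dotv p p)); first exact: dotvv_ge0.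
(* Compare p with (1 - s) p, which stays in the cone as s <= 1; this yields <p, u - p> >= 0. *)
move=> s s0 s1; have s1' : 0 <= 1 - s by rewrite subr_ge0.
have := pmin _ (KZ (1 - s) p s1' Kp).
rewrite scalerBl scale1r opprB [s *: p - p]addrC addrA; move: (u - p) => q.
by rewrite !dotv_linE (dotvC q p); lra.
Qed.

End Moreau.

(** * The polar of a polyhedron is a polyhedron *)

Section PolarPolyhedron.
Context {R : realType} {n : nat}.
Implicit Types (x y u : 'cV[R]_n) (M P : set 'cV[R]_n).

Lemma dotv_col_mx x u (c d : R) :
  dotv (col_mx x (const_mx c : 'cV_1)) (col_mx u (const_mx d : 'cV_1)) =
  dotv x u + c * d.
Proof.
by rewrite /dotv tr_col_mx mul_row_col mxE [X in _ + X]mxE big_ord1 !mxE.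
Qed.

Lemma col_mx_const (z : 'cV[R]_(n + 1)) :
  z = col_mx (usubmx z) (const_mx (dsubmx z 0 0)).
Proof.
rewrite -[LHS]vsubmxK; congr col_mx.
by apply/matrixP => i j; rewrite !ord1 [in RHS]mxE.
Qed.

(** Rows with zero normal define no halfspace and are dropped; nonnegative right-hand sides make
    them hold trivially. *)
Lemma polyhedron_of_inequalities (s : seq ('cV[R]_n * R)) :
  (forall w, w \in s -> 0 <= w.2) ->
  polyhedron [set u | forall w, w \in s -> dotv w.1 u <= w.2].
Proof.
move=> s0; pose s' := [seq w <- s | w.1 != 0].
pose w0 : 'cV[R]_n * R := (0, 0).
exists (size s').
exists (fun i => [set u | dotv (nth w0 s' i).1 u <= (nth w0 s' i).2]).
split=> [i|].
  exists (nth w0 s' i).1, (nth w0 s' i).2; split=> //.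
  by have := mem_nth w0 (ltn_ord i); rewrite mem_filter => /andP[].
apply/seteqP; split=> u /= Hu.
  move=> i _ /=; apply: Hu; have := mem_nth w0 (ltn_ord i).
  by rewrite mem_filter => /andP[].
move=> w ws; have [w10|w10] := eqVneq w.1 0; first by rewrite w10 dotv0l s0.
have ws' : w \in s' by rewrite mem_filter w10.
have lt_ws : (index w s' < size s')%N by rewrite index_mem.
by have := Hu (Ordinal lt_ws) I; rewrite /= nth_index.
Qed.

Lemma polyhedron_inequalities P : polyhedron P ->
  exists s : seq ('cV[R]_n * R),
    P = [set u | forall w, w \in s -> dotv w.1 u <= w.2].
Proof.
case=> m [H [Hhalf ->]].
have /choice[w wP] i :
    exists w : 'cV[R]_n * R, H i = [set u | dotv w.1 u <= w.2].
  by have [a [b [_ ->]]] := Hhalf i; exists (a, b).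
exists [seq w i | i <- enum 'I_m]; apply/seteqP; split=> u /= Hu.
  by move=> _ /mapP[i _ ->]; have := Hu i I; rewrite wP.
by move=> i _; rewrite wP; apply: Hu; rewrite map_f ?mem_enum.
Qed.

(** A point u is in the polar iff (u, 1) is in the cone generated by (0, 1) and the rows (a, b) of
    P. An inequality (v, c) of that cone then reads <v, u> <= -c, and the generator (0, 1) ensures
    -c >= 0. *)
Lemma polyhedron_polar P : polyhedron P -> P 0 -> polyhedron (polar P).
Proof.
move=> /polyhedron_inequalities[A PE]; rewrite PE => P0.
have A0 w : w \in A -> 0 <= w.2 by move=> /P0; rewrite dotv0r.
pose cmx (w : 'cV[R]_n * R) := col_mx w.1 (const_mx w.2 : 'cV[R]_1).
have [s [sG Gs]] := farkas (cmx (0, 1) :: [seq cmx w | w <- A]).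
pose s' := [seq (usubmx w, - dsubmx w 0 0) | w : 'cV[R]_(n + 1) <- s].
have s'0 w : w \in s' -> 0 <= w.2.
  move=> /mapP[v vs ->] /=; rewrite oppr_ge0.
  have := sG v _ vs (mem_head _ _).
  by rewrite [v in dotv v]col_mx_const /cmx dotv_col_mx dotv0r add0r mulr1.
have -> : polar [set u | forall w, w \in A -> dotv w.1 u <= w.2] =
    [set u | forall w, w \in s' -> dotv w.1 u <= w.2]; last first.
  exact: polyhedron_of_inequalities.
apply/seteqP; split=> u /= Hu.
- move=> w ws'; have [v vs wE] := mapP ws'.
  (* t w.1 is a point of P for all such t; t = 1 / w.2, or t large if w.2 = 0. *)
  have scaled_in t : 0 <= t -> t * w.2 <= 1 -> t * dotv w.1 u <= 1.
    move=> t0 tw; rewrite -dotvZl; apply: Hu => a aA; rewrite dotvZr.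
    have : dotv v (cmx a) <= 0.
      by apply: sG => //; rewrite inE; apply/orP; right; rewrite map_f.
    rewrite [v in dotv v]col_mx_const /cmx dotv_col_mx => va.
    have := A0 _ aA; have {va} : dotv a.1 w.1 <= w.2 * a.2.
      by move: va; rewrite wE /= (dotvC a.1); lra.
    move=> va a20; apply: le_trans (ler_wpM2l t0 va) _.
    by rewrite mulrA ler_piMl.
  have [w2|w2] := ltP 0 w.2.
    have := scaled_in w.2^-1; rewrite invr_ge0 ltW // mulVf ?gt_eqF //.
    move=> /(_ isT (lexx _)).
    by rewrite ler_pdivrMl // mulr1.
  have w20 : w.2 = 0 by apply/eqP; rewrite eq_le w2 s'0.
  rewrite w20 leNgt; apply/negP => wu.
  have := scaled_in (2 / dotv w.1 u); rewrite w20 mulr0 divfK ?gt_eqF //.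
  by move=> /(_ (divr_ge0 (ler0n R 2) (ltW wu)) ler01); lra.
- move=> x Px.
  (* For x in P the vector (x, -1) is nonpositive on all generators, hence on (u, 1), which says <x,
     u> - 1 <= 0. *)
  have := Gs (cmx (u, 1)) _ (cmx (x, -1)) _; rewrite /cmx dotv_col_mx /=.
  rewrite mulr1 subr_le0; apply.
    move=> v vs; rewrite [v in dotv v]col_mx_const dotv_col_mx mulr1.
    by have := Hu (usubmx v, - dsubmx v 0 0) (map_f _ vs); rewrite /=; lra.
  move=> g; rewrite inE => /orP[/eqP->|/mapP[w wA ->]];
    rewrite /cmx dotv_col_mx /=.
    by rewrite dotv0r; lra.
  by have := Px _ wA; rewrite dotvC; lra.
Qed.

End PolarPolyhedron.

(** * Homogenizations and their polar cones *)

Section Homogenization.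
Context {R : realType} {n : nat}.
Implicit Types (x y u : 'cV[R]_n) (M P : set 'cV[R]_n) (z : 'cV[R]_(n + 1)).

Lemma conical_hull_cone m (M : set 'cV[R]_m) : convex_cone (conical_hull M).
Proof.
apply/convex_coneP; split=> [K [/convex_coneP[]] //|x y Kx Ky|t x t0 Kx] K KM.
  by have [/convex_coneP[_ KD _] _] := KM; apply: KD; [apply: Kx|apply: Ky].
by have [/convex_coneP[_ _ KZ] _] := KM; apply: KZ => //; apply: Kx.
Qed.

Lemma closure_cone m (K : set 'cV[R]_m) :
  convex_cone K -> convex_cone (closure K).
Proof.
move=> /convex_coneP[K0 KD KZ]; apply/convex_coneP; split.
- exact: subset_closure.
- move=> x y Kx Ky B Bxy.
  have [[U V] /= [Ux Vy] UV] : nbhs (x, y) ((fun p => p.1 + p.2) @^-1` B).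
    exact: add_continuous.
  have [x' [Kx' Ux']] := Kx _ Ux; have [y' [Ky' Vy']] := Ky _ Vy.
  by exists (x' + y'); split; [exact: KD|exact: (UV (x', y'))].
- move=> t x t0 Kx B Bx.
  have [x' [Kx' Bx']] := Kx _ (@scaler_continuous _ _ t x _ Bx).
  by exists (t *: x'); split => //; apply: KZ.
Qed.

Lemma homog_cone M : convex_cone (homog M).
Proof. exact/closure_cone/conical_hull_cone. Qed.

Lemma homog_closed M : closed (homog M).
Proof. exact: closed_closure. Qed.

Lemma homog_generator M x : M x -> homog M (col_mx x (const_mx 1)).
Proof.
by move=> Mx; apply: subset_closure; apply: sub_gen_smallest; exists x.
Qed.

(** A closed halfspace bounded by a hyperplane through 0 is a closed convex cone, so it absorbs both
    the conical hull and the closure. *)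
Lemma homog_sub_halfspace M (w : 'cV[R]_(n + 1)) :
  (forall x, M x -> dotv w (col_mx x (const_mx 1)) <= 0) ->
  forall z, homog M z -> dotv w z <= 0.
Proof.
move=> Mw; rewrite /homog closureE; apply: smallest_sub.
  apply: (@preimage_closed _ _ (fun z => dotv w z) [set r | r <= 0]).
    move=> z _; apply: (dotv_continuous _ (cst w) id) => p; last exact: cvg_id.
    exact: cst_continuous.
  exact: closed_le.
apply: smallest_sub => [|_ [x Mx <-]]; last exact: Mw.
apply/convex_coneP; split=> /= [|x y|t x t0]; rewrite ?dotv0r // dotv_linE.
  by move=> ? ?; lra.
by move=> ?; rewrite mulr_ge0_le0.
Qed.

Definition reflect_last z : 'cV[R]_(n + 1) := col_mx (usubmx z) (- dsubmx z).

Lemma reflect_last_col_mx x (c : R) :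
  reflect_last (col_mx x (const_mx c)) = col_mx x (const_mx (- c)).
Proof.
rewrite /reflect_last col_mxKu col_mxKd; congr col_mx.
by apply/matrixP => i j; rewrite !mxE.
Qed.

Lemma reflect_lastK : involutive reflect_last.
Proof. by move=> z; rewrite [z]col_mx_const !reflect_last_col_mx opprK. Qed.

Lemma reflect_lastB z z' :
  reflect_last (z - z') = reflect_last z - reflect_last z'.
Proof. by rewrite /reflect_last opp_col_mx add_col_mx !linearB. Qed.

Lemma dotv_reflect_last z z' :
  dotv (reflect_last z) z' = dotv z (reflect_last z').
Proof.
rewrite [z]col_mx_const [z']col_mx_const !reflect_last_col_mx !dotv_col_mx.
by rewrite mulNr mulrN.
Qed.

Lemma eucl_norm_reflect_last z : eucl_norm (reflect_last z) = eucl_norm z.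
Proof. by rewrite /eucl_norm dotv_reflect_last reflect_lastK. Qed.

(** On generators the pairing is <x, u> - 1, and [homog_sub_halfspace] extends its sign in each
    argument in turn. Conversely, write z = (u, s): then <x, u> <= s on M, so u / s is in the polar
    if s > 0, and s = 0 is reached as a limit. *)
Lemma homog_polar M z : M 0 ->
  homog (polar M) z <-> polar_cone (homog M) (reflect_last z).
Proof.
move=> M0; split=> [zP x Mx|].
  rewrite -dotv_reflect_last; move: z zP.
  apply: homog_sub_halfspace => u Mu; rewrite dotv_reflect_last.
  rewrite reflect_last_col_mx dotvC; move: x Mx.
  apply: homog_sub_halfspace => x Mx.
  by rewrite dotv_col_mx dotvC; have := Mu _ Mx; lra.
rewrite [z]col_mx_const reflect_last_col_mx.
move: (usubmx z) (dsubmx z 0 0) => u s Hz.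
have Hx x : M x -> dotv x u <= s.
  by move=> /homog_generator /Hz; rewrite dotv_col_mx; lra.
have s0 : 0 <= s by have := Hx _ M0; rewrite dotv0l.
pose G := [set col_mx x (const_mx 1 : 'cV_1) | x in polar M].
(* Raising the last coordinate by e makes it positive, so that it can be scaled to 1. *)
have pos (e : R) : 0 < e -> conical_hull G (col_mx u (const_mx (s + e))).
  move=> e0; have se0 : 0 < s + e by lra.
  have [_ _ KZ] := conical_hull_cone _ G.
  rewrite (_ : col_mx _ _ = (s + e) *: col_mx ((s + e)^-1 *: u) (const_mx 1)).
    apply: KZ; first exact: ltW.
    apply: sub_gen_smallest; eexists; last by [].
    move=> x Mx; rewrite dotvZr ler_pdivrMl // mulr1.
    by have := Hx _ Mx; lra.
  rewrite scale_col_mx scalerA mulfV ?gt_eqF // scale1r; congr col_mx.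
  by apply/matrixP => i j; rewrite !mxE mulr1.
move=> B /nbhs_ballP[e /= e0 eB].
exists (col_mx u (const_mx (s + e / 2))); split.
  by apply: pos; rewrite divr_gt0.
apply: eB; split=> // i j; rewrite /ball /= !mxE.
case: (fintype.split i) => k /=; rewrite ?mxE ?subrr ?normr0 //.
by rewrite opprD addNKr normrN gtr0_norm ?divr_gt0 //; lra.
Qed.

End Homogenization.

(** * Hausdorff distance and its behaviour under polarity *)

Section Duality.
Context {R : realType} {n : nat}.
Implicit Types (x y z u : 'cV[R]_n) (K : set 'cV[R]_n) (delta e : R).

(** The slack e is there because the infimum defining the distance to B need not be attained. *)
Definition near_within delta (A B : set 'cV[R]_n) : Prop :=
  forall x e, A x -> 0 < e -> exists2 y, B y & eucl_norm (x - y) <= delta + e.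

Lemma hausdorff_distP delta (A B : set 'cV[R]_n) :
  (hausdorff_dist A B <= delta%:E)%E <->
  near_within delta A B /\ near_within delta B A.
Proof.
have sideP (C D : set 'cV[R]_n) :
    (ereal_sup [set eucl_dist x D | x in C] <= delta%:E)%E <->
    near_within delta C D.
  split=> [/ereal_supP H x e Cx e0|H].
    have : (eucl_dist x D < (delta + e)%:E)%E.
      by apply: le_lt_trans (H _ _) _; [exists x|rewrite lte_fin ltrDl].
    by move=> /ereal_inf_lt[_ [y Dy <-]]; rewrite lte_fin => /ltW; exists y.
  apply: ge_ereal_sup => _ [x Cx <-]; apply/lee_addgt0Pr => e e0.
  have [y Dy xy] := H x e Cx e0.
  apply: ge_ereal_inf; exists (eucl_norm (x - y))%:E; first by exists y.
  by rewrite -EFinD lee_fin.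
rewrite /hausdorff_dist ge_max; split=> [/andP[AB BA]|[AB BA]].
  by split; apply/sideP.
by apply/andP; split; apply/sideP.
Qed.

(** The Moreau component q = u - p does not depend on the slack e, so the bound on |p| holds for
    every e and the conclusion is free of slack. *)
Lemma near_within_polar_cone delta K1 K2 : 0 <= delta ->
  closed K1 -> convex_cone K1 ->
  near_within delta (K1 `&` eucl_ball R n) (K2 `&` eucl_ball R n) ->
  forall u, (polar_cone K2 `&` eucl_ball R n) u ->
  exists2 q, (polar_cone K1 `&` eucl_ball R n) q & eucl_norm (u - q) <= delta.
Proof.
move=> d0 K1cl K1c K12 u [K2u]; rewrite /eucl_ball /= => u1.
have [p K1p [polq pq]] := moreau K1 u K1cl K1c.
have pu : dotv p u = eucl_norm p ^+ 2.
  by rewrite -[u](subrK p) dotvDr pq add0r eucl_norm_sqr.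
exists (u - p); last rewrite opprB addrC subrK.
  (* By orthogonality |u|^2 = |p|^2 + |u - p|^2, so u - p stays in the ball. *)
  split=> //=; apply: le_trans u1; rewrite eucl_norm_le ?eucl_norm_ge0 //.
  rewrite eucl_norm_sqr; have := dotvv_ge0 p; move: pq.
  by rewrite !dotv_linE (dotvC u p); lra.
have [->|pn0] := eqVneq (eucl_norm p) 0; first exact: d0.
have p0 : 0 < eucl_norm p by rewrite lt_def pn0 eucl_norm_ge0.
apply/ler_addgt0Pr => e e0.
pose v := (eucl_norm p)^-1 *: p.
have vu : dotv v u = eucl_norm p by rewrite dotvZl pu expr2 mulKf.
have [|y [K2y y1] vy] := K12 v e _ e0.
  split; first by case/convex_coneP: K1c => _ _; apply; rewrite ?invr_ge0 ?ltW.
  rewrite /eucl_ball /= eucl_norm_le // !dotv_linE -eucl_norm_sqr expr2 expr1n.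
  by rewrite mulKf // mulVf.
(* Here |p| = <v - y, u> + <y, u>; the first term is at most |v - y| because |u| <= 1, the second is
   nonpositive. *)
rewrite -vu -[v](subrK y) dotvDl.
have := K2u _ K2y; have := cauchy_schwarz (v - y) u.
have := ler_wpM2l (eucl_norm_ge0 (v - y)) u1; lra.
Qed.

End Duality.

(** [reflect_last] is an isometric involution carrying homogenized polars to polar cones, so the
    cone estimate transfers; polarity exchanges M and N. *)
Lemma near_within_homog_polar {R : realType} {n : nat} (delta : R)
    (M N : set 'cV[R]_n) : 0 <= delta -> M 0 -> N 0 ->
  near_within delta (homog M `&` eucl_ball R (n + 1))
                    (homog N `&` eucl_ball R (n + 1)) ->
  near_within delta (homog (polar N) `&` eucl_ball R (n + 1))
                    (homog (polar M) `&` eucl_ball R (n + 1)).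
Proof.
move=> d0 M0 N0 MN z e [/(homog_polar _ _ N0) Nz z1] e0.
have [|||q [Mq q1] zq] :=
  near_within_polar_cone delta _ _ d0 _ _ MN (reflect_last z).
- exact: homog_closed.
- exact: homog_cone.
- by split=> //; rewrite /eucl_ball /= eucl_norm_reflect_last.
exists (reflect_last q).
  split; last by rewrite /eucl_ball /= eucl_norm_reflect_last.
  by apply/(homog_polar _ _ M0); rewrite reflect_lastK.
rewrite -eucl_norm_reflect_last reflect_lastB reflect_lastK.
by apply: le_trans zq _; rewrite lerDl ltW.
Qed.

Theorem theorem3p9 (R : realType) (n : nat) (C P : set 'cV[R]_n) (delta : R)
    (C_convex : convex_set C) (C_0 : C 0) (delta_ge0 : 0 <= delta)
    (P_polyhedron : polyhedron P) (P_0 : P 0)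
    (P_approx : homog_approx delta C P) :
  homog_approx delta (polar C) (polar P).
Proof.
split; first exact: polyhedron_polar.
have [_ /hausdorff_distP[PC CP]] := P_approx.
(* As polarity reverses direction, [CP] bounds the distance from the polar of P to that of C, and
   [PC] the other one. *)
by apply/hausdorff_distP; split; apply: near_within_homog_polar.
Qed.
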